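(* Let $A$ be a vector space with two commuting families of linear maps $(p_\omega)_{\omega\in\Omega},(q_\omega)_{\omega\in\Omega}:A\to A$, and let $\mu=(\mu_{\alpha,\beta})_{\alpha,\beta\in\Omega}\in \mathrm{C}^2_\Omega(A)$. Then $(A,\mu_{\alpha,\beta},p_\omega,q_\omega)_{\alpha,\beta,\omega\in\Omega}$ is a BiHom-$\Omega$-associative algebra if and only if $\mu$ is a Maurer-Cartan element of $(\mathrm{C}^{\bullet+1}_\Omega(A),[-,-]^\Omega_G)$, i.e. $[\mu,\mu]^\Omega_G=0$.
   Context: $\mathbf{k}$ is a commutative unitary ring (the base ring for all vector spaces and linear maps) and $\Omega$ is a semigroup with unit $1$. Two families of linear endomorphisms $(p_\omega),(q_\omega)$ are commuting if $p_\alpha\circ q_\beta=q_\beta\circ p_\alpha$ for all $\alpha,\beta\in\Omega$. A BiHom-$\Omega$-associative algebra $(A,\mu_{\alpha,\beta},p_\omega,q_\omega)$ is a vector space $A$ with two commuting families of linear maps $p_\omega,q_\omega:A\to A$ and bilinear maps $\mu_{\alpha,\beta}:A\otimes A\to A$ such that for all $x,y,z\in A$, $\alpha,\beta,\gamma\in\Omega$: $p_{\alpha\beta}\mu_{\alpha,\beta}(x,y)=\mu_{\alpha,\beta}(p_\alpha(x),p_\beta(y))$, $q_{\alpha\beta}\mu_{\alpha,\beta}(x,y)=\mu_{\alpha,\beta}(q_\alpha(x),q_\beta(y))$, $\mu_{\alpha,\beta\gamma}(p_\alpha(x),\mu_{\beta,\gamma}(y,z))=\mu_{\alpha\beta,\gamma}(\mu_{\alpha,\beta}(x,y),q_\gamma(z))$.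 For $n\ge1$, $\mathrm{C}^n_\Omega(A)$ is the space of families $f=(f_{\alpha_1,\dots,\alpha_n}:A^{\otimes n}\to A)_{\alpha_1,\dots,\alpha_n\in\Omega}$ of multilinear maps with $p_{\alpha_1\cdots\alpha_n}\circ f_{\alpha_1,\dots,\alpha_n}=f_{\alpha_1,\dots,\alpha_n}\circ(p_{\alpha_1},\dots,p_{\alpha_n})$ and $q_{\alpha_1\cdots\alpha_n}\circ f_{\alpha_1,\dots,\alpha_n}=f_{\alpha_1,\dots,\alpha_n}\circ(q_{\alpha_1},\dots,q_{\alpha_n})$. Put $\mathrm{C}^{\bullet+1}_\Omega(A)=\bigoplus_{n\ge0}\mathrm{C}^{n+1}_\Omega(A)$, with $f\in\mathrm{C}^n_\Omega(A)$ of degree $|f|=n-1$. For $f\in\mathrm{C}^n_\Omega(A)$, $g\in\mathrm{C}^m_\Omega(A)$, $1\le i\le n$, define $f\diamond^\Omega_i g\in\mathrm{C}^{n+m-1}_\Omega(A)$ by $$(f\diamond^\Omega_i g)_{\alpha_1,\dots,\alpha_{n+m-1}}=f_{\alpha_1,\dots,\alpha_{i-1},\alpha_i\cdots\alpha_{i+m-1},\alpha_{i+m},\dots,\alpha_{n+m-1}}\big(p^{m-1}_{\alpha_1},\dots,p^{m-1}_{\alpha_{i-1}},g_{\alpha_i,\dots,\alpha_{i+m-1}},q^{m-1}_{\alpha_{i+m}},\dots,q^{m-1}_{\alpha_{n+m-1}}\big),$$ where powers denote iterated composition. The BiHom-$\Omega$-Gerstenhaber bracket is $$[f,g]^\Omega_G=\sum_{i=1}^n(-1)^{(m-1)(i-1)}f\diamond^\Omega_i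 g-(-1)^{(n-1)(m-1)}\sum_{i=1}^m(-1)^{(n-1)(i-1)}g\diamond^\Omega_i f.$$ It makes $\mathrm{C}^{\bullet+1}_\Omega(A)$ a graded Lie algebra.
   Formalization: The converse (Maurer-Cartan implies BiHom-Ω-associative) is stated for A without 2-torsion; over a ring such as F_2 every μ satisfies [μ,μ]=0, so the equivalence fails there. The forward direction is stated without restriction. *)

(* Defs.v *)
From HB Require Import structures.
From mathcomp Require Import all_boot all_order all_algebra.
From mathcomp Require Import boolp classical_sets functions.

Set Implicit Arguments.
Unset Strict Implicit.
Unset Printing Implicit Defensive.

Import GRing.Theory.
Local Open Scope ring_scope.

(* Tuples (t_1, ..., t_n) are functions 'I_n -> T, so that a
   1-based position i is encoded as i.-1 : 'I_n. *)

Definition upd (T : Type) (n : nat) (x : 'I_n -> T) (i : 'I_n) (u : T) :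
  'I_n -> T := fun j => if j == i then u else x j.

Definition pair_tuple (T : Type) (a b : T) : 'I_2 -> T := tnth [tuple a; b].

Section BiHomOmega.

Variables (k : comPzRingType) (Omega : monoidType) (A : lmodType k).
Implicit Types (p q : Omega -> {linear A -> A}).

Definition commuting_families p q : Prop :=
  forall (a b : Omega) (x : A), p a (q b x) = q b (p a x).

Definition bilinear_map (m : A -> A -> A) : Prop :=
  (forall x, linear (m x)) /\ (forall y, linear (m^~ y)).

Record is_BiHom_Omega_assoc (mu : Omega -> Omega -> A -> A -> A) p q : Prop := {
  bha_commuting : commuting_families p q;
  bha_bilinear : forall a b, bilinear_map (mu a b);
  bha_p : forall a b x y,
    p (a * b)%g (mu a b x y) = mu a b (p a x) (p b y);
  bha_q : forall a b x y,
    q (a * b)%g (mu a b x y) = mu a b (q a x) (q b y);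
  bha_assoc : forall a b c x y z,
    mu a (b * c)%g (p a x) (mu b c y z) = mu (a * b)%g c (mu a b x y) (q c z)
}.

(* Families of maps A^n -> A indexed by Omega^n; being a function space into A,
   this type carries the pointwise k-module structure of the library. *)
Definition Omega_family (n : nat) : Type :=
  ('I_n -> Omega) -> ('I_n -> A) -> A.
HB.instance Definition _ n := GRing.Lmodule.on (Omega_family n).

Definition multilinear (n : nat) (f : ('I_n -> A) -> A) : Prop :=
  forall (x : 'I_n -> A) (i : 'I_n), linear (fun u => f (upd x i u)).

Definition compatible (n : nat) p (f : Omega_family n) : Prop :=
  forall (a : 'I_n -> Omega) (x : 'I_n -> A),
    p (\prod_i a i)%g (f a x) = f a (fun i => p (a i) (x i)).

Record is_cochain p q (n : nat) (f : Omega_family n) : Prop := {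
  cochain_multilinear : forall a, multilinear (f a);
  cochain_p : compatible p f;
  cochain_q : compatible q f
}.

Section Diamond.

Variables (p q : Omega -> {linear A -> A}) (n m : nat).

(* (t_i, ..., t_{i+m}), of length m.+1 *)
Definition block (T : Type) (i : 'I_n.+1) (t : 'I_(n + m).+1 -> T) :
  'I_m.+1 -> T := fun l => t (inord (i + l)).

Definition diamond_index (i : 'I_n.+1) (a : 'I_(n + m).+1 -> Omega) :
  'I_n.+1 -> Omega :=
  fun j => if (j < i)%N then a (inord j)
           else if j == i then (\prod_l block i a l)%g
           else a (inord (j + m)).

Definition diamond_arg (i : 'I_n.+1) (g : Omega_family m.+1)
    (a : 'I_(n + m).+1 -> Omega) (x : 'I_(n + m).+1 -> A) : 'I_n.+1 -> A :=
  fun j => if (j < i)%N then iter m (p (a (inord j))) (x (inord j))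
           else if j == i then g (block i a) (block i x)
           else iter m (q (a (inord (j + m)))) (x (inord (j + m))).

(* Here f has arity n.+1 and g has arity m.+1, i.e. |f| = n and |g| = m; the
   result has arity (n.+1 + m.+1).-1 = (n + m).+1. *)
Definition diamond (f : Omega_family n.+1) (i : 'I_n.+1)
    (g : Omega_family m.+1) :
  Omega_family (n + m).+1 :=
  fun a x => f (diamond_index i a) (diamond_arg i g a x).

End Diamond.

Definition cast_family (n m : nat) (e : n = m) (f : Omega_family n) :
  Omega_family m :=
  fun a x => f (a \o cast_ord e) (x \o cast_ord e).

Definition pre_bracket p q (n m : nat)
    (f : Omega_family n.+1) (g : Omega_family m.+1) :
  Omega_family (n + m).+1 :=
  \sum_(i < n.+1) (-1) ^+ (m * i) *: diamond p q f i g.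

(* The second sum naturally lives in arity (m + n).+1. *)
Definition gerstenhaber_bracket p q (n m : nat)
    (f : Omega_family n.+1) (g : Omega_family m.+1) : Omega_family (n + m).+1 :=
  pre_bracket p q f g
  - (-1) ^+ (n * m) *:
      cast_family (congr1 succn (addnC m n)) (pre_bracket p q g f).

(* Maurer-Cartan elements of the graded Lie algebra of cochains (with zero
   differential): elements of degree 1, i.e. arity 2, of zero self-bracket. *)
Definition is_Maurer_Cartan p q (mu : Omega_family 2) : Prop :=
  is_cochain p q mu /\ gerstenhaber_bracket p q mu mu = 0.

Definition binary (mu : Omega_family 2) (a b : Omega) (x y : A) : A :=
  mu (pair_tuple a b) (pair_tuple x y).

(* Since [mu, mu] = 2 (mu <>_1 mu - mu <>_2 mu), the vanishing of the bracket
   only yields associativity when A has no 2-torsion (e.g. 2 invertible in k):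
   over a field of characteristic 2 every mu satisfies [mu, mu] = 0. *)
Definition two_torsion_free : Prop := forall x : A, x *+ 2 = 0 -> x = 0.

Lemma is_cochain0 p q n : is_cochain p q (0 : Omega_family n).
Proof.
split=> [a x i c u v|a x|a x]; rewrite ?linear0 //.
by rewrite [RHS](_ : _ = c *: 0 + 0 :> A) // scaler0 addr0.
Qed.

Lemma is_cochain_lin p q n (c : k) (f g : Omega_family n) :
  is_cochain p q f -> is_cochain p q g -> is_cochain p q (c *: f + g).
Proof.
have E a x : (c *: f + g) a x = c *: f a x + g a x by [].
case=> fl fp fq [gl gp gq]; split=> [a x i d u v|a x|a x]; rewrite !E.
- have := fl a x i d u v; have := gl a x i d u v; rewrite /= => -> ->.
  by rewrite !scalerDr !scalerA mulrC addrACA.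
- by rewrite linearP fp gp.
- by rewrite linearP fq gq.
Qed.

Lemma is_cochain_sum p q n (I : finType) (c : I -> k)
    (f : I -> Omega_family n) :
  (forall i, is_cochain p q (f i)) -> is_cochain p q (\sum_i c i *: f i).
Proof.
move=> fC; elim/big_rec: _ => [|i g _ gC]; first exact: is_cochain0.
exact: is_cochain_lin.
Qed.

Lemma is_cochain_cast p q n m (e : n = m) (f : Omega_family n) :
  is_cochain p q f -> is_cochain p q (cast_family e f).
Proof.
case: m / e; suff -> : cast_family erefl f = f by [].
rewrite /cast_family; apply/funext=> a; apply/funext=> x.
by congr (f _ _); apply/funext=> i /=; rewrite cast_ord_id.
Qed.

Lemma prod_diamond_index n m (i : 'I_n.+1) (a : 'I_(n + m).+1 -> Omega) :
  (\prod_j diamond_index i a j = \prod_j a j)%g.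
Proof.
pose F j := a (inord j).
have -> : (\prod_j a j = \prod_(0 <= j < (n + m).+1) F j)%g.
  by rewrite big_mkord; apply: eq_bigr => j _; rewrite /F inord_val.
pose G j := if (j < i)%N then F j
  else if j == i then (\prod_l block i a l)%g else F (j + m)%N.
have -> : (\prod_j diamond_index i a j = \prod_(0 <= j < n.+1) G j)%g.
  by rewrite big_mkord.
have ilt := ltn_ord i; have ile : (i <= n)%N by [].
rewrite (@big_cat_nat _ _ _ i) //=; last exact: ltnW.
rewrite [in RHS](@big_cat_nat _ _ _ i) //=; last first.
  by rewrite (leq_trans ile) // -addnS leq_addr.
congr (_ * _)%g.
  by apply: eq_big_nat => j /andP[_ ji]; rewrite /G ji.
rewrite big_ltn // /G ltnn eqxx.
rewrite [in RHS](@big_cat_nat _ _ _ (i + m.+1)) ?leq_addr //=; last first.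
  by rewrite addnS ltnS leq_add2r.
congr (_ * _)%g.
  have -> : (\prod_(i <= j < i + m.+1) F j
             = \prod_(0 + i <= j < i + m.+1) F j)%g by rewrite add0n.
  rewrite big_addn addKn big_mkord; apply: eq_bigr => l _.
  by rewrite /block /F [(l + i)%N]addnC.
rewrite -[in RHS]addSnnS big_addn subSn ?leq_addl // addnK.
apply: eq_big_nat => j /andP[ij _].
by rewrite ltnNge (ltnW ij) /= gtn_eqF.
Qed.

Lemma iter_linear m (f : {linear A -> A}) : linear (iter m f).
Proof.
by move=> c u v; elim: m => //= m ->; rewrite linearP.
Qed.

Lemma iter_comm m (f g : A -> A) x :
  (forall y, g (f y) = f (g y)) -> g (iter m f x) = iter m f (g x).
Proof. by move=> fg; elim: m => //= m <-. Qed.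

Lemma is_cochain_diamond p q n m (f : Omega_family n.+1) i
    (g : Omega_family m.+1) :
  commuting_families p q -> is_cochain p q f -> is_cochain p q g ->
  is_cochain p q (diamond p q f i g).
Proof.
move=> pq [fl fp fq] [gl gp gq]; split.
- move=> a x l c u v /=; rewrite /diamond.
  have slot j (phi : A -> A) : linear phi ->
      (forall w, diamond_arg p q i g a (upd x l w) =
                 upd (diamond_arg p q i g a x) j (phi w)) ->
      f (diamond_index i a) (diamond_arg p q i g a (upd x l (c *: u + v))) =
      c *: f (diamond_index i a) (diamond_arg p q i g a (upd x l u))
      + f (diamond_index i a) (diamond_arg p q i g a (upd x l v)).
    by move=> phil E; rewrite !E phil; apply: fl.
  have ile : (i <= n)%N by rewrite -ltnS.
  have nnm j : (j <= n)%N -> (j < (n + m).+1)%N.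
    by move=> jn; rewrite ltnS (leq_trans jn) ?leq_addr.
  have Ein j (jlt : (j < (n + m).+1)%N) : (inord j == l) = (j == l :> nat).
    by rewrite -val_eqE /= inordK.
  have Eblock w : ~~ (i <= l <= i + m)%N -> block i (upd x l w) = block i x.
    move=> il; apply/funext=> s; rewrite /block /upd Ein; last first.
      by rewrite ltnS leq_add // -ltnS.
    case: eqP => // sl; move: il; rewrite -sl leq_addr leq_add2l.
    by rewrite -ltnS ltn_ord.
  case: (ltnP l i) => [li|il].
    pose j : 'I_n.+1 := inord l.
    have jl : j = l :> nat by rewrite inordK // ltnS (leq_trans _ ile) // ltnW.
    apply: (slot j (iter m (p (a l)))); first exact: iter_linear.
    move=> w; apply/funext=> s; rewrite /diamond_arg [RHS]/upd.
    rewrite -(inj_eq val_inj s j) /= jl; case: ifP => si.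
      rewrite /upd !Ein; last by rewrite nnm // -ltnS.
      by case: eqP => // ->; rewrite inord_val.
    rewrite Eblock; last by rewrite leqNgt li.
    rewrite gtn_eqF; last by rewrite (leq_trans li) // leqNgt si.
    case: eqP => // _; congr (iter _ _ _); rewrite /upd Ein; last first.
      by rewrite ltnS leq_add2r -ltnS.
    rewrite gtn_eqF // ltn_addr // (leq_trans li) // leqNgt si //.
  case: (leqP l (i + m)) => [lim|iml].
    pose s : 'I_m.+1 := inord (l - i)%N.
    have sl : s = (l - i)%N :> nat by rewrite inordK // ltnS leq_subLR.
    apply: (slot i (fun w => g (block i a) (upd (block i x) s w))).
      by move=> d y z; apply: gl.
    move=> w; apply/funext=> j; rewrite /diamond_arg [RHS]/upd.
    case: ifP => ji.
      rewrite [j == i]ltn_eqF //; congr (iter _ _ _).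
      rewrite /upd Ein; last by rewrite nnm // -ltnS.
      by rewrite ltn_eqF // (leq_trans ji).
    case: eqP => [_|/eqP jni].
      congr (g _ _); apply/funext=> t; rewrite /block /upd Ein; last first.
        by rewrite ltnS leq_add // -ltnS.
      by rewrite -(inj_eq val_inj t s) /= sl -[in RHS](eqn_add2l i) subnKC.
    congr (iter _ _ _); rewrite /upd Ein; last by rewrite ltnS leq_add2r -ltnS.
    rewrite gtn_eqF // (leq_ltn_trans lim) // ltn_add2r.
    by rewrite ltn_neqAle eq_sym jni leqNgt ji.
  have ml : (m <= l)%N by rewrite (leq_trans _ (ltnW iml)) ?leq_addl.
  pose j : 'I_n.+1 := inord (l - m)%N.
  have jl : j = (l - m)%N :> nat
    by rewrite inordK // ltnS leq_subLR [(m + n)%N]addnC -ltnS.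
  have ij : (i < l - m)%N by rewrite ltn_subRL [(m + i)%N]addnC.
  apply: (slot j (iter m (q (a l)))); first exact: iter_linear.
  move=> w; apply/funext=> s; rewrite /diamond_arg [RHS]/upd.
  rewrite -(inj_eq val_inj s j) /= jl; case: ifP => si.
    rewrite ltn_eqF ?(ltn_trans si) //; congr (iter _ _ _).
    rewrite /upd Ein; last by rewrite nnm // -ltnS.
    by rewrite ltn_eqF // (leq_trans si).
  case: eqP => [->|/eqP sni].
    by rewrite ltn_eqF // Eblock // negb_and -!ltnNge iml orbT.
  rewrite /upd Ein; last by rewrite ltnS leq_add2r -ltnS.
  rewrite -[in RHS](eqn_add2r m) subnK //; case: eqP => // ->.
  by rewrite inord_val.
- move=> a x; rewrite /diamond -(prod_diamond_index i) fp.
  congr (f _ _); apply/funext=> j; rewrite /diamond_arg /diamond_index.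
  case: ifP => _; first exact: iter_comm.
  case: ifP => _; first exact: gp.
  by apply: iter_comm => y; apply: pq.
- move=> a x; rewrite /diamond -(prod_diamond_index i) fq.
  congr (f _ _); apply/funext=> j; rewrite /diamond_arg /diamond_index.
  case: ifP => _; first by apply: iter_comm => y; rewrite pq.
  case: ifP => _; first exact: gq.
  exact: iter_comm.
Qed.

Lemma is_cochain_bracket p q n m (f : Omega_family n.+1)
    (g : Omega_family m.+1) :
  commuting_families p q -> is_cochain p q f -> is_cochain p q g ->
  is_cochain p q (gerstenhaber_bracket p q f g).
Proof.
move=> pq fC gC; rewrite /gerstenhaber_bracket addrC -scaleNr.
apply: is_cochain_lin; first apply: is_cochain_cast.
  all: by apply: is_cochain_sum => i; apply: is_cochain_diamond.
Qed.

End BiHomOmega.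

(* Main.v *)
Require Import Defs.
From HB Require Import structures.
From mathcomp Require Import all_boot all_order all_algebra.
From mathcomp Require Import boolp classical_sets functions.

Set Implicit Arguments.
Unset Strict Implicit.
Unset Printing Implicit Defensive.

Import GRing.Theory.
Local Open Scope ring_scope.

(** The cochain conditions on a binary family [mu] are, through the
    identification of pairs with functions on ['I_2], exactly the bilinearity
    and multiplicativity axioms of a BiHom-Omega-associative algebra, so only
    associativity is at stake. Since [mu] has odd degree 1, the two halves of
    [[mu, mu]] are equal up to a sign that turns their difference into a sum
    ([bracket_self_odd]), whence
    [[mu, mu] = 2 (mu <>_1 mu - mu <>_2 mu)] ([bracket_binary]). The two
    compositions are the two bracketings
    [mu (mu (x, y), q z)] and [mu (p x, mu (y, z))]
    ([diamond_first], [diamond_second]): associativity makes the bracket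
    vanish, and the converse holds as soon as 2 can be cancelled in [A]. *)

Section Pairs.

Variables (T : Type) (a b : T).

Lemma eq_pair_tuple (t : 'I_2 -> T) :
  t ord0 = a -> t ord_max = b -> t = pair_tuple a b.
Proof.
by move=> <- <-; apply/funext=> -[[|[|//]] h]; rewrite /pair_tuple /tnth /=;
  congr t; apply: val_inj.
Qed.

Lemma upd_pair_first u : upd (pair_tuple a b) ord0 u = pair_tuple u b.
Proof. by apply/funext=> -[[|[|//]] h]. Qed.

Lemma upd_pair_second u : upd (pair_tuple a b) ord_max u = pair_tuple a u.
Proof. by apply/funext=> -[[|[|//]] h]. Qed.

End Pairs.

Section Bracket.

Variables (k : comPzRingType) (Omega : monoidType) (A : lmodType k).
Variables (p q : Omega -> {linear A -> A}).
Implicit Types (mu : Omega_family Omega A 2).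

Lemma prod_pair_tuple (a b : Omega) : (\prod_i pair_tuple a b i = a * b)%g.
Proof. by rewrite big_ord_recl big_ord1. Qed.

Lemma cast_family_id n (e : n = n) (f : Omega_family Omega A n) :
  cast_family e f = f.
Proof.
apply/funext=> a; apply/funext=> x; rewrite /cast_family.
by congr (f _ _); apply/funext=> i /=; rewrite cast_ord_id.
Qed.

(** For [g = f] the two halves of the bracket are the same sum, entering with
    relative sign [- (-1) ^+ (n * n)]. This is [+1] for odd [n], so they add up
    instead of cancelling. *)
Lemma bracket_self_odd n (f : Omega_family Omega A n.+1) :
  odd n -> gerstenhaber_bracket p q f f = pre_bracket p q f f *+ 2.
Proof.
move=> n_odd; rewrite /gerstenhaber_bracket cast_family_id.
by rewrite -signr_odd oddM n_odd /= expr1 scaleN1r opprK mulr2n.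
Qed.

Lemma bracket_binary mu :
  gerstenhaber_bracket p q mu mu =
  (diamond p q mu ord0 mu - diamond p q mu ord_max mu) *+ 2.
Proof.
rewrite bracket_self_odd // /pre_bracket big_ord_recl big_ord1 /=.
rewrite muln0 expr0 scale1r muln1 expr1 scaleN1r.
by congr ((_ - diamond _ _ _ _ _) *+ 2); apply: val_inj.
Qed.

(** The inner product has arity 2, so the maps [p] and [q] compensating for it
    occur to the first power: here only [q], on the third argument, and in
    [diamond_second] only [p], on the first. *)
Lemma diamond_first mu (a : 'I_3 -> Omega) (x : 'I_3 -> A) :
  diamond p q mu (ord0 : 'I_2) mu a x =
  binary mu (a (inord 0) * a (inord 1))%g (a (inord 2))
    (binary mu (a (inord 0)) (a (inord 1)) (x (inord 0)) (x (inord 1)))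
    (q (a (inord 2)) (x (inord 2))).
Proof.
rewrite /diamond /binary; congr (mu _ _); apply: eq_pair_tuple => //.
  by rewrite /diamond_index /= big_ord_recl big_ord1.
by congr (mu _ _); apply: eq_pair_tuple.
Qed.

Lemma diamond_second mu (a : 'I_3 -> Omega) (x : 'I_3 -> A) :
  diamond p q mu (ord_max : 'I_2) mu a x =
  binary mu (a (inord 0)) (a (inord 1) * a (inord 2))%g
    (p (a (inord 0)) (x (inord 0)))
    (binary mu (a (inord 1)) (a (inord 2)) (x (inord 1)) (x (inord 2))).
Proof.
rewrite /diamond /binary; congr (mu _ _); apply: eq_pair_tuple => //.
  by rewrite /diamond_index /= big_ord_recl big_ord1.
by congr (mu _ _); apply: eq_pair_tuple.
Qed.

Lemma binary_bilinear mu (a b : Omega) :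
  is_cochain p q mu -> bilinear_map (binary mu a b).
Proof.
case=> mu_lin _ _; split=> [x|y] c u v; rewrite /binary.
  have := mu_lin (pair_tuple a b) (pair_tuple x 0) ord_max c u v.
  by rewrite /= !upd_pair_second.
have := mu_lin (pair_tuple a b) (pair_tuple 0 y) ord0 c u v.
by rewrite /= !upd_pair_first.
Qed.

Lemma binary_compatible (r : Omega -> {linear A -> A}) mu (a b : Omega) x y :
  compatible r mu ->
  r (a * b)%g (binary mu a b x y) = binary mu a b (r a x) (r b y).
Proof.
move=> /(_ (pair_tuple a b) (pair_tuple x y)); rewrite prod_pair_tuple /binary.
by move=> ->; congr (mu _ _); apply: eq_pair_tuple.
Qed.

End Bracket.

Theorem proposition3p8 (k : comPzRingType) (Omega : monoidType)
    (A : lmodType k) (p q : Omega -> {linear A -> A})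
    (mu : Omega_family Omega A 2)
    (pq_comm : commuting_families p q) (mu_cochain : is_cochain p q mu) :
  (is_BiHom_Omega_assoc (binary mu) p q -> is_Maurer_Cartan p q mu) /\
  (two_torsion_free A ->
     is_Maurer_Cartan p q mu -> is_BiHom_Omega_assoc (binary mu) p q).
Proof.
split=> [[_ _ _ _ assoc]|tf [_ mu_mc]].
  split=> //; rewrite bracket_binary.
  suff -> : diamond p q mu ord0 mu = diamond p q mu ord_max mu.
    by rewrite subrr mul0rn.
  apply/funext=> a; apply/funext=> x.
  by rewrite diamond_first diamond_second assoc.
split=> // [a b|a b x y|a b x y|a b c x y z].
- exact: binary_bilinear mu_cochain.
- exact: binary_compatible (cochain_p mu_cochain).
- exact: binary_compatible (cochain_q mu_cochain).
pose s := tnth [tuple a; b; c]; pose t := tnth [tuple x; y; z].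
have E : (diamond p q mu ord0 mu s t - diamond p q mu ord_max mu s t) *+ 2 = 0.
  by have := congr1 (fun f : Omega_family Omega A 3 => f s t) mu_mc;
    rewrite bracket_binary.
move/tf/subr0_eq: E; rewrite diamond_first diamond_second.
by rewrite /s /t !(tnth_nth a) !(tnth_nth x) !inordK.
Qed.
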